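(* Let $d\in K$, let $a\in K^\times$ and let $G_a$ be the inner automorphism $G_a(x)=(a^{-1}x)a$ of $(K,\delta,d)$. Then $G_a=H_{\mathrm{id},\,a^{-1}\delta(a)}$.
   Context: $p$ is a prime, $K$ is a field of characteristic $p$ and $\delta:K\to K$ is an algebraic derivation with $F=\mathrm{Const}(\delta)=\{a\in K\mid\delta(a)=0\}$ strictly contained in $K$ and with minimum polynomial $g(t)=t^{p^s}+a_1t^{p^{s-1}}+\dots+a_st\in F[t]$ of degree $p^s$. $R=K[t;\delta]$ is the differential polynomial ring: polynomials with left coefficients in $K$, multiplication determined by $ta=at+\delta(a)$. For monic $f\in R$ of degree $m$, every $h\in R$ can be written uniquely as $h=qf+r$ with $\deg r<m$; write $r=h\bmod_r f$. $R/Rf$ is the set of polynomials of degree $<m$ with the usual addition and multiplication $g\circ h=gh\bmod_r f$, a unital, in general nonassociative, $F$-algebra. For $f(t)=g(t)-d$ it is denoted $(K,\delta,d)$. For $\tau\in\mathrm{Aut}(K)$ and $c\in K$, $H_{\tau,c}$ denotes the map $\sum_{i=0}^{p^s-1}b_it^i\mapsto\sum_{i=0}^{p^s-1}\tau(b_i)(t+c)^i$ on $(K,\delta,d)$. *)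

(* Defs.v *)
From HB Require Import structures.
From mathcomp Require Import all_boot all_order all_algebra.
From mathcomp Require Import ring.

Set Implicit Arguments.
Unset Strict Implicit.
Unset Printing Implicit Defensive.

Import GRing.Theory.
Local Open Scope ring_scope.

Record derivation (K : fieldType) := Derivation {
  der :> {additive K -> K};
  derM : forall a b : K, der (a * b) = der a * b + a * der b
}.

Section DerivationTheory.
Variables (K : fieldType) (delta : derivation K).

Lemma der1 : delta 1 = 0.
Proof.
by apply: (@addrI _ (delta 1)); rewrite addr0 -{3}[1]mulr1 derM mulr1 mul1r.
Qed.

Definition Const : {pred K} := [pred a | delta a == 0].

Lemma Const_divring : divring_closed Const.
Proof.
split=> [|a b|a b]; rewrite !inE ?der1 //.
- by move=> /eqP a0 /eqP b0; rewrite raddfB a0 b0 subr0.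
- move=> /eqP a0 /eqP b0; have [->|nz_b] := eqVneq b 0.
    by rewrite invr0 mulr0 raddf0.
  have /eqP := der1; rewrite -(mulfV nz_b) derM b0 mul0r add0r mulf_eq0.
  by rewrite (negPf nz_b) derM a0 mul0r add0r => /eqP->; rewrite mulr0.
Qed.

HB.instance Definition _ :=
  GRing.isDivringClosed.Build K Const Const_divring.

(* The operator h(delta), applied to x. *)
Definition der_eval (h : {poly K}) (x : K) : K :=
  \sum_(i < size h) h`_i * iter i delta x.

Definition algebraic_derivation : Prop :=
  exists h : {poly K},
    [/\ h \is a polyOver Const, h != 0 & forall x, der_eval h x = 0].

(* The minimum polynomial of delta as an F-linear operator, F = Const delta;
   polynomials over F are represented in {poly K} via polyOver. *)
Record minpoly := MinPoly {
  minp :> {poly K};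
  minp_monic : minp \is monic;
  minp_over : minp \is a polyOver Const;
  minp_annih : forall x, der_eval minp x = 0;
  minp_min : forall h : {poly K}, h \is a polyOver Const -> h != 0 ->
    (forall x, der_eval h x = 0) -> (size minp <= size h)%N
}.

End DerivationTheory.

(* The differential polynomial ring K[t; delta].  An element is encoded by its
   list of left coefficients, so 'X^i stands for t^i; the additive and left
   K-module structures are those of {poly K}, only the product changes. *)
Definition dpoly (K : fieldType) (delta : derivation K) : Type := {poly K}.

Section DPoly.
Variables (K : fieldType) (delta : derivation K).
Local Notation R := (dpoly delta).

HB.instance Definition _ := GRing.Lmodule.on R.

(* Left multiplication by t: t (sum b_i t^i) = sum b_i t^(i+1) + delta(b_i) t^i *)
Definition dmulX (q : {poly K}) : {poly K} := q * 'X + map_poly delta q.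

Definition dmul (p q : {poly K}) : {poly K} :=
  \sum_(i < size p) p`_i *: iter i dmulX q.

Lemma dmulX_is_zmod_morphism : zmod_morphism dmulX.
Proof.
move=> p q; rewrite /dmulX mulrBl raddfB /=.
by rewrite opprD addrACA.
Qed.
HB.instance Definition _ :=
  GRing.isZmodMorphism.Build {poly K} {poly K} dmulX dmulX_is_zmod_morphism.

Lemma dmulXZ c (q : {poly K}) : dmulX (c *: q) = c *: dmulX q + delta c *: q.
Proof.
apply/polyP=> i; rewrite !(coefD, coefZ, coefMX, coef_map) derM.
by case: i => [|i] /=; ring.
Qed.

Lemma dmulXXn i : dmulX 'X^i = 'X^(i.+1).
Proof.
rewrite /dmulX -exprSr -[RHS]addr0; congr (_ + _); apply/polyP=> j.
by rewrite coef_map coefXn coef0; case: eqP => _; rewrite ?der1 ?raddf0.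
Qed.

Lemma iter_dmulX_is_zmod_morphism i : zmod_morphism (iter i dmulX).
Proof. by elim: i => [//|i IHi] p q; rewrite !iterS IHi raddfB. Qed.
HB.instance Definition _ i :=
  GRing.isZmodMorphism.Build {poly K} {poly K} (iter i dmulX)
    (iter_dmulX_is_zmod_morphism i).

Lemma dmul_widen n (p q : {poly K}) : (size p <= n)%N ->
  dmul p q = \sum_(i < n) p`_i *: iter i dmulX q.
Proof.
move=> le_p_n; rewrite /dmul (big_ord_widen n (fun i => p`_i *: iter i dmulX q)) //.
rewrite big_mkcond /=; apply: eq_bigr => i _; case: ltnP => // le_p_i.
by rewrite nth_default ?scale0r.
Qed.

Lemma dmulDl : left_distributive dmul +%R.
Proof.
move=> p1 p2 q; pose n := maxn (size p1) (size p2).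
rewrite !(@dmul_widen n) ?leq_maxl ?leq_maxr ?size_polyD // -big_split /=.
by apply: eq_bigr => i _; rewrite coefD scalerDl.
Qed.

Lemma dmulDr : right_distributive dmul +%R.
Proof.
move=> p q1 q2; rewrite /dmul -big_split /=.
by apply: eq_bigr => i _; rewrite raddfD scalerDr.
Qed.

Lemma dmulZl c p q : dmul (c *: p) q = c *: dmul p q.
Proof.
rewrite (@dmul_widen (size p)) ?size_scale_leq // /dmul scaler_sumr.
by apply: eq_bigr => i _; rewrite coefZ scalerA.
Qed.

Lemma dmul0l q : dmul 0 q = 0.
Proof. by rewrite /dmul size_poly0 big_ord0. Qed.

Lemma dmulXnl i q : dmul 'X^i q = iter i dmulX q.
Proof.
rewrite /dmul size_polyXn big_ord_recr /= coefXn eqxx scale1r big1 ?add0r //.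
by move=> j _; rewrite coefXn ltn_eqF ?scale0r.
Qed.

Lemma dmulCl c q : dmul c%:P q = c *: q.
Proof. by rewrite -alg_polyC -(expr0 'X) dmulZl dmulXnl. Qed.

Lemma dmul_suml n (F : 'I_n -> {poly K}) q :
  dmul (\sum_(i < n) F i) q = \sum_(i < n) dmul (F i) q.
Proof.
by apply: (big_morph (dmul^~ q)) => [p1 p2|]; rewrite ?dmulDl ?dmul0l.
Qed.

Lemma dmulXl q r : dmul (dmulX q) r = dmulX (dmul q r).
Proof.
rewrite -[q]coefK poly_def raddf_sum !dmul_suml raddf_sum.
apply: eq_bigr => i _; rewrite /= dmulXZ dmulDl !dmulZl dmulXXn !dmulXnl.
by rewrite dmulXZ.
Qed.

Lemma dmulA : associative dmul.
Proof.
move=> p q r; rewrite [dmul p q]/dmul dmul_suml [LHS]/dmul.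
apply: eq_bigr => i _; rewrite dmulZl; congr (_ *: _).
by elim: (i : nat) => [//|j IHj]; rewrite !iterS dmulXl IHj.
Qed.

Lemma dmul1l : left_id 1 dmul.
Proof. by move=> q; rewrite dmulCl scale1r. Qed.

Lemma dmul1r : right_id 1 dmul.
Proof.
move=> p; rewrite /dmul -[RHS]coefK poly_def; apply: eq_bigr => i _.
by congr (_ *: _); elim: (i : nat) => [|j IHj]; rewrite ?expr0 // iterS IHj dmulXXn.
Qed.

HB.instance Definition _ := GRing.Zmodule_isNzRing.Build R
  dmulA dmul1l dmul1r dmulDl dmulDr (oner_neq0 {poly K}).

Definition dC (c : K) : R := c%:P.
Definition dX : R := 'X.

Lemma dX_dC (c : K) : dX * dC c = dC c * dX + dC (delta c).
Proof.
rewrite /dX /dC [LHS](dmulXnl 1) [X in X + _]dmulCl /= /dmulX map_polyC /=.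
by rewrite -mul_polyC.
Qed.

Lemma dXnE i : dX ^+ i = ('X^i : {poly K}).
Proof. by elim: i => [//|i IHi]; rewrite exprS IHi [LHS](dmulXnl 1) /= dmulXXn. Qed.

Lemma dC_mulE (c : K) (q : R) : dC c * q = c *: q.
Proof. exact: dmulCl. Qed.

End DPoly.

Section RightDivision.
Variables (K : fieldType) (delta : derivation K).
Local Notation R := (dpoly delta).

Definition dsize (h : R) : nat := size (h : {poly K}).
Definition dmonic (f : R) : bool := (f : {poly K}) \is monic.

(* Left multiplication of a monic f by b t^k keeps the leading term, so the
   leading term of h is cancelled from the left; n bounds the number of steps *)
Fixpoint rmod_rec (f h : R) (n : nat) : R :=
  if n is n'.+1 then
    if (dsize h < dsize f)%N then h
    else rmod_rec f
      (h - dC delta (lead_coef h) * dX delta ^+ (dsize h - dsize f) * f) n'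
  else h.

(* The remainder h mod_r f; see rmodP for its characterization. *)
Definition rmod (f h : R) : R := rmod_rec f h (dsize h).

Lemma dXn_monic i (f : R) : dmonic f ->
  dmonic (dX delta ^+ i * f) /\ dsize (dX delta ^+ i * f) = (i + dsize f)%N.
Proof.
rewrite /dmonic /dsize => mf; elim: i => [|i [mi si]].
  by rewrite expr0 mul1r add0n.
rewrite exprS -mulrA; set g := _ * f in mi si *.
rewrite (_ : dX delta * g = dmulX delta g); last first.
  by rewrite [LHS](dmulXnl delta 1).
have nz_g : (g : {poly K}) != 0 by exact: monic_neq0.
have lt_g : (size (map_poly delta (g : {poly K})) <
             size ((g : {poly K}) * 'X)%R)%N.
  rewrite size_mulX // ltnS; apply/leq_sizeP => j le_g_j.
  by rewrite coef_map nth_default // raddf0.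
split; last by rewrite /dmulX size_polyDl // size_mulX // si addSn.
by rewrite monicE lead_coefDl // lead_coefMX -monicE.
Qed.

Lemma dC_dXn_mul (c : K) i (f : R) : dmonic f -> c != 0 ->
  dsize (dC delta c * dX delta ^+ i * f) = (i + dsize f)%N /\
  lead_coef (dC delta c * dX delta ^+ i * f : {poly K}) = c.
Proof.
move=> mf nz_c; rewrite -mulrA dC_mulE; have [mi si] := dXn_monic i mf.
rewrite /dsize [size _](size_scale _ nz_c) -si [lead_coef _]lead_coefZ.
by rewrite (monicP mi) mulr1.
Qed.

Lemma rmod_rec_spec (f h : R) n : dmonic f -> (dsize h <= n)%N ->
  (dsize (rmod_rec f h n) < dsize f)%N /\
  exists q : R, h = q * f + rmod_rec f h n.
Proof.
move=> mf; have f_gt0 : (0 < dsize f)%N.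
  by rewrite lt0n size_poly_eq0 monic_neq0.
elim: n h => [|n IHn] h le_h /=.
  split; first by rewrite (leq_ltn_trans le_h).
  by exists 0; rewrite mul0r add0r.
case: (ltnP (dsize h)) => [lt_h|le_f].
  by split=> //; exists 0; rewrite mul0r add0r.
set u := dC delta _ * _.
have nz_l : lead_coef (h : {poly K}) != 0.
  by rewrite lead_coef_eq0 -size_poly_gt0 (leq_trans f_gt0).
have [su lu] := dC_dXn_mul (dsize h - dsize f) mf nz_l.
rewrite -/u subnK // in su lu.
have lt_hu : (dsize (h - u * f)%R < dsize h)%N.
  have h_gt0 := leq_trans f_gt0 le_f.
  rewrite -(prednK h_gt0) ltnS; apply/leq_sizeP => j.
  rewrite leq_eqVlt coefB => /predU1P[<-|lt_j].
    by move: lu; rewrite !lead_coefE -/(dsize _) su => ->; rewrite subrr.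
  rewrite prednK // in lt_j.
  by rewrite !nth_default ?subr0 // -/(dsize _) su.
have [|lt_r [q def_r]] := IHn (h - u * f).
  by rewrite -ltnS (leq_trans lt_hu).
split=> //; exists (q + u); rewrite mulrDl addrAC -def_r.
by rewrite subrK.
Qed.

Lemma dsize_mul (q f : R) : dmonic f -> q != 0 ->
  dsize (q * f) = (dsize q + dsize f).-1.
Proof.
rewrite /dsize => mf; have [n] := ubnP (size (q : {poly K})).
elim: n q => // n IHn q lt_q nz_q.
have q_gt0 : (0 < size (q : {poly K}))%N by rewrite size_poly_gt0.
have nz_l : lead_coef (q : {poly K}) != 0 by rewrite lead_coef_eq0.
pose u : R := dC delta (lead_coef (q : {poly K})) *
  dX delta ^+ (size (q : {poly K})).-1.
have [su lu] := dC_dXn_mul (size (q : {poly K})).-1 mf nz_l.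
rewrite -/u /dsize in su lu.
have uE : u = lead_coef (q : {poly K}) *: 'X^((size (q : {poly K})).-1).
  by rewrite /u dC_mulE dXnE.
have lt_qu : (size ((q - u)%R : {poly K}) < size (q : {poly K}))%N.
  rewrite -(prednK q_gt0) ltnS; apply/leq_sizeP => j le_j.
  rewrite uE coefB coefZ coefXn; have [->|ne_j] := eqVneq j.
    by rewrite mulr1 -lead_coefE subrr.
  rewrite mulr0 subr0 nth_default // -(prednK q_gt0) ltn_neqAle le_j andbT.
  by rewrite eq_sym.
have sz_uf : size (u * f : {poly K}) = (size (q : {poly K}) + dsize f).-1.
  by rewrite su -{2}(prednK q_gt0) addSn.
have -> : q * f = u * f + (q - u) * f by rewrite -mulrDl addrC subrK.
have [->|nz_qu] := eqVneq (q - u) 0; first by rewrite mul0r addr0.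
have f_gt0 : (0 < dsize f)%N by rewrite lt0n size_poly_eq0 monic_neq0.
have s2 : size ((q - u) * f : {poly K}) =
    (size ((q - u)%R : {poly K}) + dsize f).-1.
  by rewrite IHn //; rewrite -ltnS (leq_trans _ lt_q) // ltnS.
rewrite [size _]size_polyDl -/(dsize _) // /dsize s2 sz_uf.
by rewrite -(prednK f_gt0) !addnS /= ltn_add2r.
Qed.

Lemma rmodP (f h r : R) : dmonic f ->
  ((dsize r < dsize f)%N /\ exists q : R, h = q * f + r) <-> r = rmod f h.
Proof.
move=> mf; have [lt_r0 [q0 def_h]] := rmod_rec_spec mf (leqnn (dsize h)).
split=> [[lt_r [q def_hq]]|->]; last by split=> //; exists q0.
rewrite -/(rmod f h) in lt_r0 def_h.
have eq_r : (q0 - q) * f = r - rmod f h.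
  rewrite mulrBl; apply: (addIr (rmod f h)); rewrite subrK addrAC -def_h def_hq.
  by rewrite addrAC subrr add0r.
have [q0q|nz_q] := eqVneq (q0 - q) 0.
  by apply/eqP; rewrite -subr_eq0 -eq_r q0q mul0r.
have lt_d : (dsize (r - rmod f h)%R < dsize f)%N.
  by rewrite (leq_ltn_trans (size_polyD _ _)) // size_polyN gtn_max lt_r.
have q_gt0 : (0 < dsize (q0 - q)%R)%N by rewrite /dsize size_poly_gt0.
move: lt_d; rewrite -eq_r dsize_mul // -(prednK q_gt0) addSn /=.
by rewrite ltnNge leq_addl.
Qed.

Lemma rmod_size (f h : R) : dmonic f -> (dsize (rmod f h) < dsize f)%N.
Proof. by move=> mf; case: (rmod_rec_spec mf (leqnn (dsize h))). Qed.

End RightDivision.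

Record monic_dpoly (K : fieldType) (delta : derivation K) := MonicDPoly {
  mdp :> dpoly delta;
  mdpP : dmonic mdp
}.

Section Petit.
Variables (K : fieldType) (delta : derivation K) (f : monic_dpoly delta).
Local Notation R := (dpoly delta).

(* The carrier of R/Rf: the polynomials of degree < deg f. *)
Definition low_degree : {pred R} := [pred h : R | (dsize h < dsize f)%N].

Lemma low_degree_submod : submod_closed low_degree.
Proof.
have f_gt0 : (0 < dsize f)%N.
  by rewrite lt0n size_poly_eq0 monic_neq0 //; exact: mdpP.
split=> [|c h1 h2]; first by rewrite inE /dsize size_poly0.
rewrite !inE => lt1 lt2; rewrite (leq_ltn_trans (size_polyD _ _)) //.
by rewrite gtn_max lt2 andbT (leq_ltn_trans (size_scale_leq _ _)).
Qed.
HB.instance Definition _ :=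
  GRing.isSubmodClosed.Build K R low_degree low_degree_submod.

Record petit := Petit { pval :> R; pvalP : pval \in low_degree }.

HB.instance Definition _ := [isSub for pval].
HB.instance Definition _ := [Choice of petit by <:].
HB.instance Definition _ := [SubChoice_isSubLmodule of petit by <:].

Definition petit_of (h : R) : petit := Petit (rmod_size h (mdpP f)).

(* The generally nonassociative product g o h = g h mod_r f of R/Rf. *)
Definition petit_mul (x y : petit) : petit := petit_of (pval x * pval y).

(* The element of R/Rf given by the constant polynomial c. *)
Definition petitC (c : K) : petit := petit_of (dC delta c).

Lemma petit_ofE (h : R) : (dsize h < dsize f)%N -> pval (petit_of h) = h.
Proof.
move=> lt_h; symmetry; apply/rmodP; first exact: mdpP.
by split=> //; exists 0; rewrite mul0r add0r.
Qed.

Definition inner_map (a : K) (x : petit) : petit :=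
  petit_mul (petit_mul (petitC a^-1) x) (petitC a).

End Petit.

Record field_aut (K : fieldType) := FieldAut {
  aut_fun :> {rmorphism K -> K};
  aut_bij : bijective aut_fun
}.

Definition id_aut (K : fieldType) : field_aut K :=
  @FieldAut K idfun (Bijective (fun=> erefl) (fun=> erefl)).

Section KDD.
Variables (K : fieldType) (delta : derivation K).

Lemma minpoly_size (g : minpoly delta) : (1 < size (g : {poly K}))%N.
Proof.
rewrite ltnNge; apply/negP => le_g; have := minp_annih g 1.
have g1 : (g : {poly K}) = 1.
  have /size1_polyC def_g := le_g; have := monicP (minp_monic g).
  by rewrite def_g lead_coefC => ->.
by rewrite /der_eval g1 size_poly1 big_ord1 coef1 mul1r; apply/eqP/oner_neq0.
Qed.

Lemma kdd_modulus_monic (g : minpoly delta) (d : K) :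
  @dmonic K delta ((g : {poly K}) - d%:P).
Proof.
rewrite /dmonic monicE lead_coefDl -?monicE ?minp_monic //.
by rewrite size_polyN (leq_ltn_trans (size_polyC_leq1 d)) ?minpoly_size.
Qed.

(* f(t) = g(t) - d *)
Definition kdd_modulus (g : minpoly delta) (d : K) : monic_dpoly delta :=
  MonicDPoly (kdd_modulus_monic g d).

(* The algebra (K, delta, d). *)
Definition kdd (g : minpoly delta) (d : K) : Type := petit (kdd_modulus g d).

Lemma petitC_kdd (g : minpoly delta) (d c : K) :
  pval (petitC (kdd_modulus g d) c) = dC delta c.
Proof.
apply: petit_ofE; rewrite (leq_ltn_trans (size_polyC_leq1 c)) //.
rewrite /dsize /= size_polyDl ?minpoly_size //.
by rewrite size_polyN (leq_ltn_trans (size_polyC_leq1 d)) ?minpoly_size.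
Qed.

(* H_{tau,c}; deg g is p^s, and the sum already has degree < deg g, so that
   petit_of does not reduce it (kdd_HE). *)
Definition kdd_H (g : minpoly delta) (d : K) (tau : field_aut K) (c : K)
    (x : kdd g d) : kdd g d :=
  petit_of (kdd_modulus g d)
    (\sum_(i < (size (g : {poly K})).-1)
       dC delta (tau (pval x : {poly K})`_i) * (dX delta + dC delta c) ^+ i).

Lemma dsize_XDC_exp (c : K) i : dsize ((dX delta + dC delta c) ^+ i) = i.+1.
Proof.
have mono : dmonic (dX delta + dC delta c).
  exact: (monicXaddC c).
elim: i => [|i IHi]; first by rewrite expr0 /dsize size_poly1.
have nz : (dX delta + dC delta c) ^+ i != 0 by rewrite -size_poly_gt0 -/(dsize _) IHi.
by rewrite exprSr dsize_mul // IHi /dsize /dX /dC size_XaddC addnC.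
Qed.

Lemma kdd_HE (g : minpoly delta) (d : K) (tau : field_aut K) (c : K)
    (x : kdd g d) :
  pval (kdd_H tau c x) =
    \sum_(i < (size (g : {poly K})).-1)
       dC delta (tau (pval x : {poly K})`_i) * (dX delta + dC delta c) ^+ i.
Proof.
have g_gt0 := ltnW (minpoly_size g).
apply: petit_ofE; rewrite [dsize (kdd_modulus g d)]size_polyDl; last first.
  by rewrite size_polyN (leq_ltn_trans (size_polyC_leq1 d)) ?minpoly_size.
rewrite (leq_ltn_trans (size_sum _ _ _)) //= -(prednK g_gt0) ltnS.
apply/bigmax_leqP => i _; rewrite dC_mulE.
rewrite (leq_trans (size_scale_leq _ _)) //.
by rewrite -/(dsize _) dsize_XDC_exp.
Qed.

End KDD.

(* Main.v *)
Require Import Defs.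
From mathcomp Require Import all_boot all_order all_algebra.

Import GRing.Theory.
Local Open Scope ring_scope.

(** In [R] one has [a^-1 t a = t + a^-1 delta(a)], so conjugation by [a] maps
    [b t^i] to [b (t + a^-1 delta(a))^i].  Conjugation by a constant does not
    raise the degree, hence neither product in [(a^-1 x) a] is reduced modulo
    [f], and the inner map is conjugation in [R]. *)

Lemma dC_mul (K : fieldType) (delta : derivation K) (a b : K) :
  dC delta a * dC delta b = dC delta (a * b).
Proof. by rewrite dC_mulE /dC -mul_polyC -polyCM. Qed.

(** Conjugation by [a] is multiplicative, so the case of [t] propagates to its powers by
    induction. *)
Lemma dX_exp_conj (K : fieldType) (delta : derivation K) (a : K) (i : nat) :
  a != 0 ->
  dC delta a^-1 * dX delta ^+ i * dC delta a =
    (dX delta + dC delta (a^-1 * delta a)) ^+ i.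
Proof.
move=> a_neq0; elim: i => [|i IHi].
  by rewrite !expr0 mulr1 dC_mul mulVf.
(* Stripping [a^-1] and [t^i] on the left leaves [t a = a (t + a^-1 delta(a))]. *)
rewrite !exprSr -IHi -!mulrA; do 2!congr (_ * _).
by rewrite dX_dC mulrDr dC_mul mulrA mulfV // mul1r.
Qed.

Lemma dpoly_sum_low (K : fieldType) (delta : derivation K) (n : nat)
    (h : dpoly delta) : (dsize h <= n)%N ->
  h = \sum_(i < n) dC delta (h : {poly K})`_i * dX delta ^+ i.
Proof.
(* Writing [h] as [h * 1] exposes the sum that defines the product of [R]. *)
move=> le_h; rewrite -[LHS](dmul1r delta) (@dmul_widen _ _ n) //.
by apply: eq_bigr => i _; rewrite dC_mulE -dmulXnl dmul1r dXnE.
Qed.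

Lemma dsize_kdd_modulus (K : fieldType) (delta : derivation K)
    (g : minpoly delta) (d : K) :
  dsize (kdd_modulus g d) = size (g : {poly K}).
Proof.
by rewrite [LHS]size_polyDl // size_polyN
  (leq_ltn_trans (size_polyC_leq1 d)) ?minpoly_size.
Qed.

(** The product with [a^-1] on the left only scales coefficients, so a size bound is needed for the
    second product alone. *)
Lemma pval_inner_map (K : fieldType) (delta : derivation K)
    (g : minpoly delta) (d a : K) (x : kdd g d) :
  (dsize (dC delta a^-1 * pval x * dC delta a)%R < dsize (kdd_modulus g d))%N ->
  pval (inner_map a x) = dC delta a^-1 * pval x * dC delta a.
Proof.
move=> lt_h.
have mulCx : pval (petit_mul (petitC (kdd_modulus g d) a^-1) x) =
    dC delta a^-1 * pval x.
  rewrite /petit_mul petitC_kdd petit_ofE // dC_mulE.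
  exact: leq_ltn_trans (size_scale_leq _ _) (pvalP x).
by rewrite /inner_map {1}/petit_mul mulCx petitC_kdd petit_ofE.
Qed.

Theorem theorem15 (p : nat) (K : fieldType) (delta : derivation K)
    (s : nat) (c : 'I_s -> K) (g : minpoly delta) (d a : K)
    (charK : p \in [pchar K])
    (delta_alg : algebraic_derivation delta)
    (F_proper : exists x : K, x \notin Const delta)
    (c_const : forall i : 'I_s, c i \in Const delta)
    (def_g : (g : {poly K}) =
       'X^(p ^ s) + \sum_(i < s) c i *: 'X^(p ^ (s - i.+1)))
    (a_neq0 : a != 0) :
  forall x : kdd g d,
    inner_map a x = kdd_H (id_aut K) (a^-1 * delta a) x.
Proof.
move=> x.
have conjE : dC delta a^-1 * pval x * dC delta a =
    pval (kdd_H (id_aut K) (a^-1 * delta a) x).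
  have le_x : (dsize (pval x) <= (size (g : {poly K})).-1)%N.
    rewrite -ltnS prednK ?(ltnW (minpoly_size g)) //.
    by rewrite -(dsize_kdd_modulus _ _ g d); exact: pvalP.
  rewrite kdd_HE {1}(dpoly_sum_low _ _ _ _ le_x) mulr_sumr mulr_suml.
  apply: eq_bigr => i _; rewrite -dX_exp_conj // !mulrA !dC_mul.
  (* In the field [K], [a^-1] commutes with the coefficient [b_i] and so can stand next to [t^i]. *)
  by rewrite [a^-1 * _]mulrC.
(* The size bound for the conjugate is read off the [kdd_H] side, which is already an element of the
   algebra. *)
by apply: val_inj; rewrite [LHS]pval_inner_map conjE //; exact: pvalP.
Qed.
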